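(* Assume that the bounded bilinear form $b:Y\times V\to\mathbb{R}$ satisfies the following: there is a constant $C_b>0$ with $$C_b\|y\|_Y\le \sup_{0\ne v\in V}\frac{b(y,v)}{\|v\|_V}\quad\forall y\in Y,\qquad\text{and}\qquad \{v\in V: b(y,v)=0\ \text{for all } y\in Y\}=\{0\}.$$ Assume also that $\Pi:V\to V_h$ is a Fortin operator. Let $(\bar{\mathsf y},\bar{\mathsf u})\in Y\times U_{ad}$ be the unique solution of the continuous optimal control problem and $(\bar{\mathsf y}_h,\bar{\mathsf u}_h)\in Y_h\times U_{ad,h}$ the unique solution of the discrete optimal control problem, and let $(\bar\lambda,\bar{\mathsf p})\in Y\times V$ and $(\bar\lambda_h,\bar{\mathsf p}_h)\in Y_h\times V_h$ be the corresponding optimal adjoint state and discrete optimal adjoint state (all defined in the context). Let $\tilde{\mathsf u}\in U_{ad}$ (assumed to exist and to be computable) satisfy $$(\mathcal I_{U'}^{U}D^*\bar{\mathsf p}_h+\alpha\tilde{\mathsf u},\mathsf u-\tilde{\mathsf u})_U\ge0\qquad\forall\mathsf u\in U_{ad}.$$ Then $$\|\tilde{\mathsf u}-\bar{\mathsf u}_h\|_U\le\|\tilde{\mathsf u}-\bar{\mathsf u}\|_U+\|\bar{\mathsf u}-\bar{\mathsf u}_h\|_U,\qquad \|D\bar{\mathsf u}_h-B\bar{\mathsf y}_h\|_{V'}\lesssim\|\bar{\mathsf y}-\bar{\mathsf y}_h\|_Y+\|\bar{\mathsf u}-\bar{\mathsf u}_h\|_U,$$ and $$\|O^*\mathcal I_{\mathcal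 Y}^{\mathcal Y'}(O\bar{\mathsf y}_h-\mathsf y_d)-B^*\bar{\mathsf p}_h\|_{Y'}\lesssim\|\bar{\mathsf p}-\bar{\mathsf p}_h\|_V+\|\bar{\mathsf y}-\bar{\mathsf y}_h\|_Y .$$
   Context: $U,Y,V,\mathcal Y$ are real Hilbert spaces; $U_{ad}\subseteq U$ is non-empty, bounded, closed and convex; $b:Y\times V\to\mathbb{R}$ is a bounded bilinear form and $B:Y\to V'$ is given by $\langle By,v\rangle_{V',V}=b(y,v)$; $O:Y\to\mathcal Y$ and $D:U\to V'$ are bounded linear operators; $\mathsf y_d\in\mathcal Y$ and $\alpha>0$ are given. The cost functional is $J(\mathsf y,\mathsf u):=\tfrac12\|O\mathsf y-\mathsf y_d\|_{\mathcal Y}^2+\tfrac{\alpha}{2}\|\mathsf u\|_U^2$. For a bounded linear operator $T$, $T^*$ is its dual; biduals are identified with the original Hilbert spaces, so $B^*:V\to Y'$ and $D^*:V\to U'$. $\mathcal I_{X}^{X'}:X\to X'$ is the canonical (Riesz) isomorphism, and $\mathcal I_{X'}^{X}$ is its inverse. Continuous problem: minimize $J(\mathsf y,\mathsf u)$ over $(\mathsf y,\mathsf u)\in Y\times U_{ad}$ subject to $b(\mathsf y,v)=\langle D\mathsf u,v\rangle_{V',V}$ for all $v\in V$. The optimal adjoint state $(\bar\lambda,\bar{\mathsf p})\in Y\times V$ is the unique solution of $$(\bar{\mathsf p},v)_V-b(\bar\lambda,v)=0,\quad b(w,\bar{\mathsf p})=\langle O^*\mathcal I_{\mathcal Y}^{\mathcal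 Y'}(O\bar{\mathsf y}-\mathsf y_d),w\rangle_{Y',Y}\quad\forall(v,w)\in V\times Y.$$ Discretization: $V_h\subseteq V$ and $Y_h\subseteq Y$ are finite-dimensional subspaces, and $U_h\subseteq U$ is a (not necessarily discrete) subspace with $U_{ad,h}:=U_h\cap U_{ad}\neq\emptyset$; the choice $U_h=U$ is allowed. The operator $\Theta_h:Y\to V_h$ is defined by $(\Theta_h\mathsf y,v_h)_V=b(\mathsf y,v_h)$ for all $v_h\in V_h$, and $V_h^{\Theta_h}:=\Theta_h(Y_h)$. A map $\Pi:V\to V_h$ is a Fortin operator if there is $C_\Pi>0$ such that $\|\Pi v\|_V\le C_\Pi\|v\|_V$ and $b(\mathsf y_h,v-\Pi v)=0$ for all $\mathsf y_h\in Y_h$, $v\in V$. Discrete problem: minimize $J(\mathsf y_h,\mathsf u_h)$ over $(\mathsf y_h,\mathsf u_h)\in Y_h\times U_{ad,h}$ subject to $b(\mathsf y_h,v_h)=\langle D\mathsf u_h,v_h\rangle_{V',V}$ for all $v_h\in V_h^{\Theta_h}$. The discrete optimal adjoint state $(\bar\lambda_h,\bar{\mathsf p}_h)\in Y_h\times V_h$ is the unique solution of $$(\bar{\mathsf p}_h,v_h)_V-b(\bar\lambda_h,v_h)=0,\quad b(w_h,\bar{\mathsf p}_h)=\langle O^*\mathcal I_{\mathcal Y}^{\mathcal Y'}(O\bar{\mathsf y}_h-\mathsf y_d),w_h\rangle_{Y',Y}\quad\forall(v_h,w_h)\in V_h\times Y_h.$$ Notation: $A\lesssim R$ is the usual shorthand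 for $A\le C\,R$ with a generic constant $C>0$. *)

(* Defs.v *)
From HB Require Import structures.
From mathcomp Require Import all_boot all_order all_algebra.
From mathcomp Require Import sesquilinear.
From mathcomp Require Import ring lra.
From mathcomp Require Import all_classical all_reals all_analysis.

Set Implicit Arguments.
Unset Strict Implicit.
Unset Printing Implicit Defensive.

Import Order.TTheory GRing.Theory Num.Theory.
Import numFieldNormedType.Exports.

Local Open Scope classical_set_scope.
Local Open Scope ring_scope.

HB.mixin Record isHilbert (R : realType) V & CompleteNormedModule R V := {
  inner : {dot V for idfun};
  inner_norm : forall x : V, `|x| ^+ 2 = inner x x }.

#[short(type="hilbertType")]
HB.structure Definition Hilbert (R : realType) :=
  {V of isHilbert R V & CompleteNormedModule R V}.

#[short(type="boundedLinearType")]
HB.structure Definition BoundedLinear (R : realType) (E F : normedModType R) :=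
  {f of @GRing.Linear R E F *:%R f & @Continuous E F f}.

Notation "{ 'bounded_linear' E -> F }" := (boundedLinearType E%type F%type)
  (at level 0, E at level 98, F at level 99,
   format "{ 'bounded_linear'  E  ->  F }") : type_scope.

HB.mixin Record isBoundedForm (R : realType) (E F : normedModType R)
    (b : E -> F -> R) := {
  form_bounded : exists M : R, forall x y, `|b x y| <= M * `|x| * `|y| }.

#[short(type="boundedBilinearType")]
HB.structure Definition BoundedBilinear (R : realType) (E F : normedModType R) :=
  {b of isBoundedForm R E F b & @Bilinear R E F R *%R *%R b}.

Notation "{ 'bounded_biscalar' E -> F }" := (boundedBilinearType E%type F%type)
  (at level 0, E at level 98, F at level 99,
   format "{ 'bounded_biscalar'  E  ->  F }") : type_scope.

Section Operators.
Context {R : realType}.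

Lemma ex_bound_continuous (E F : normedModType R) (f : {linear E -> F}) (M : R) :
  (forall x, `|f x| <= M * `|x|) -> continuous f.
Proof.
move=> fM; apply/bounded_linear_continuous/linear_boundedP.
exists M; split=> [|r /ltW Mr x]; first exact: num_real.
by rewrite (le_trans (fM x)) ?ler_wpM2r.
Qed.

Lemma continuous_ex_bound (E F : normedModType R) (f : {linear E -> F}) :
  continuous f -> exists2 M : R, 0 <= M & forall x, `|f x| <= M * `|x|.
Proof.
move=> /linear_bounded_continuous/linear_boundedP fr.
by have /pinfty_ex_gt0[M /ltW M0 fM] := fr; exists M.
Qed.

End Operators.

(* The topological dual, normed by the operator norm. *)
Section Dual.
Context {R : realType} (E : normedModType R).

Definition dual_pred : {pred E -> R^o} :=
  [pred f | `[< linear f /\ continuous f >]].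

Record dual := Dual { dual_fun :> E -> R^o; dualP : dual_fun \in dual_pred }.

HB.instance Definition _ := [isSub for dual_fun].
HB.instance Definition _ := [Choice of dual by <:].

Lemma dual_predP f : reflect (linear f /\ continuous f) (f \in dual_pred).
Proof. exact: asboolP. Qed.

Lemma dual_submod_closed : GRing.submod_closed dual_pred.
Proof.
split=> [|a f g /dual_predP[lf cf] /dual_predP[lg cg]]; apply/dual_predP; split.
- by move=> a x y; rewrite scaler0 addr0.
- by move=> x; exact: cvg_cst.
- move=> c x y; rewrite !fctE /= lf lg !scalerDr addrACA; congr (_ + _).
  by rewrite !scalerA mulrC.
- by move=> x; apply: cvgD; [apply: cvgZr; exact: cf|exact: cg].
Qed.

HB.instance Definition _ :=
  GRing.isSubmodClosed.Build R (E -> R^o) dual_pred dual_submod_closed.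
HB.instance Definition _ := [SubChoice_isSubLmodule of dual by <:].

Lemma dual_linear (f : dual) : linear f.
Proof. by case: f => f /= /dual_predP[]. Qed.

Lemma dual_continuous (f : dual) : continuous f.
Proof. by case: f => f /= /dual_predP[]. Qed.

HB.instance Definition _ (f : dual) :=
  GRing.isLinear.Build R E R^o *:%R (dual_fun f) (dual_linear f).
HB.instance Definition _ (f : dual) :=
  isContinuous.Build E R^o (dual_fun f) (dual_continuous (f:=f)).

Definition dual_norm (f : dual) : R :=
  sup [set `|f x| / `|x| | x in [set x | x != 0]].

Lemma dual_norm_le (f : dual) (M : R) : 0 <= M ->
  (forall x, `|f x| <= M * `|x|) -> dual_norm f <= M.
Proof.
move=> M0 fM; rewrite /dual_norm; set A := [set _ | _ in _].
have [->|A0] := eqVneq A set0; first by rewrite sup0.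
apply: ge_sup; first exact/set0P.
by move=> _ [x /= x0 <-]; rewrite ler_pdivrMr ?normr_gt0.
Qed.

Lemma le_dual_norm (f : dual) x : `|f x| <= dual_norm f * `|x|.
Proof.
have [->|x0] := eqVneq x 0; first by rewrite linear0 !normr0 mulr0.
have [M M0 fM] := continuous_ex_bound (dual_continuous (f:=f)).
rewrite -ler_pdivrMr ?normr_gt0//; apply: ub_le_sup; last first.
  by exists x.
by exists M => _ [y /= y0 <-]; rewrite ler_pdivrMr ?normr_gt0//; exact: fM.
Qed.

Lemma dual_norm_ge0 f : 0 <= dual_norm f.
Proof.
rewrite /dual_norm; set A := [set _ | _ in _].
have [->|/set0P[_ [x /= x0 _]]] := eqVneq A set0; first by rewrite sup0.
have x_gt0 : 0 < `|x| by rewrite normr_gt0.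
by rewrite -(pmulr_lge0 _ x_gt0); apply: le_trans (le_dual_norm f x).
Qed.

Lemma dual_normD f g : dual_norm (f + g) <= dual_norm f + dual_norm g.
Proof.
apply: dual_norm_le => [|x]; first by rewrite addr_ge0 ?dual_norm_ge0.
by rewrite mulrDl (le_trans (ler_normD _ _)) ?lerD ?le_dual_norm.
Qed.

Lemma dual_normZ (a : R) f : dual_norm (a *: f) = `|a| * dual_norm f.
Proof.
have le c (g : dual) : dual_norm (c *: g) <= `|c| * dual_norm g.
  apply: dual_norm_le => [|x]; first by rewrite mulr_ge0 ?dual_norm_ge0.
  by rewrite normrZ -mulrA ler_wpM2l ?le_dual_norm.
have [->|a0] := eqVneq a 0.
  rewrite normr0 mul0r; apply/le_anti; rewrite dual_norm_ge0 andbT.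
  by rewrite (le_trans (le _ _)) ?normr0 ?mul0r.
apply/le_anti; rewrite le /= -ler_pdivlMl ?normr_gt0// -normfV.
by rewrite -{1}[f]scale1r -(mulVf a0) -scalerA le.
Qed.

Lemma dual_norm0_eq0 f : dual_norm f = 0 -> f = 0.
Proof.
move=> f0; apply/val_inj/funext => x /=; apply/eqP.
by rewrite -normr_le0 (le_trans (le_dual_norm f x)) ?f0 ?mul0r.
Qed.

HB.instance Definition _ :=
  Lmodule_isNormed.Build R dual dual_normD dual_normZ dual_norm0_eq0.

End Dual.

Arguments dual_pred {R E}.

Section Duality.
Context {R : realType}.

(* The dual operator T* : F' -> E' of T : E -> F. *)
Section Adjoint.
Context (E F : normedModType R) (T : {bounded_linear E -> F}).

Definition adjoint_fun (f : dual F) : E -> R^o := f \o T.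

Lemma adjoint_subproof f : adjoint_fun f \in dual_pred.
Proof.
apply/dual_predP; split=> [a x y|x]; first by rewrite /adjoint_fun /= !linearP.
by apply: continuous_comp; [exact: cts_fun|exact: cts_fun].
Qed.

Definition adjoint (f : dual F) : dual E := Dual (adjoint_subproof f).

End Adjoint.

(* The canonical embedding of E into its bidual. *)
Section Bidual.
Context (E : normedModType R).

Definition eval_at (x : E) : dual E -> R^o := fun f => f x.

Lemma eval_at_subproof x : eval_at x \in dual_pred.
Proof.
have lx : linear (eval_at x) by [].
apply/dual_predP; split=> //.
pose h : {linear dual E -> R^o} :=
  HB.pack (eval_at x) (GRing.isLinear.Build R (dual E) R^o *:%R (eval_at x) lx).
apply: (@ex_bound_continuous _ _ _ h `|x|) => f.
by rewrite mulrC; exact: le_dual_norm.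
Qed.

Definition bidual (x : E) : dual (dual E) := Dual (eval_at_subproof x).

End Bidual.

(* T* for T : E -> F', seen as an operator F -> E' through F = F''. *)
Definition adjoint_to_dual (E F : normedModType R)
    (T : {bounded_linear E -> dual F}) (x : F) : dual E :=
  adjoint T (bidual x).

End Duality.

Section FormOperator.
Context {R : realType} (E F : normedModType R) (b : {bounded_biscalar E -> F}).

Lemma form_op_subproof (x : E) : (b x : F -> R^o) \in dual_pred.
Proof.
have lx : linear (b x : F -> R^o) by move=> a u v; exact: linearPr.
apply/dual_predP; split=> //.
have [M bM] := @form_bounded _ _ _ b.
pose h : {linear F -> R^o} :=
  HB.pack (b x : F -> R^o)
    (GRing.isLinear.Build R F R^o *:%R (b x : F -> R^o) lx).
exact: (@ex_bound_continuous _ _ _ h (M * `|x|) (bM x)).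
Qed.

(* The operator B : E -> F' of the form, <B x, y> = b(x, y). *)
Definition form_op (x : E) : dual F := Dual (form_op_subproof x).

Lemma form_op_linear : linear form_op.
Proof. by move=> a u v; apply/val_inj/funext => y; exact: linearPl. Qed.

HB.instance Definition _ :=
  GRing.isLinear.Build R E (dual F) *:%R form_op form_op_linear.

Lemma form_op_continuous : continuous form_op.
Proof.
have [M bM] := @form_bounded _ _ _ b.
apply: (@ex_bound_continuous _ _ _ form_op `|M|) => x.
apply: dual_norm_le => [|y]; first by rewrite mulr_ge0.
rewrite (le_trans (bM x y))// ler_wpM2r// ler_wpM2r//.
exact: ler_norm.
Qed.

HB.instance Definition _ :=
  isContinuous.Build E (dual F) form_op form_op_continuous.

End FormOperator.

Section Riesz.
Context {R : realType} (X : hilbertType R).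

Lemma inner_sym (x y : X) : inner x y = inner y x.
Proof. by have := @hermitian_subproof _ _ _ _ (inner : {dot X for idfun}) x y; rewrite expr0 mul1r. Qed.

Lemma cauchy_schwarz (x y : X) : `|inner x y| <= `|x| * `|y|.
Proof.
have le (u v : X) : inner u v <= `|u| * `|v|.
  have [->|u0] := eqVneq u 0; first by rewrite linear0l normr0 mul0r.
  have [->|v0] := eqVneq v 0; first by rewrite linear0r normr0 mulr0.
  have := sqr_ge0 `|(`|v| *: u - `|u| *: v)|.
  rewrite inner_norm linearBl !linearBr !linearZl_LR !linearZr_LR /=.
  rewrite -!inner_norm (inner_sym v u).
  have uv0 : 0 < `|u| * `|v| by rewrite mulr_gt0 ?normr_gt0.
  by rewrite -(ler_pM2l uv0) /GRing.scale /=; nra.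
rewrite ler_norml le andbT lerNl -[x in _ <= `|x| * _]opprK normrN.
by rewrite -linearNl le.
Qed.

Lemma riesz_subproof (x : X) : (inner x : X -> R^o) \in dual_pred.
Proof.
have lx : linear (inner x : X -> R^o) by move=> a u v; exact: linearPr.
apply/dual_predP; split=> //.
pose h : {linear X -> R^o} :=
  HB.pack (inner x : X -> R^o)
    (GRing.isLinear.Build R X R^o *:%R (inner x : X -> R^o) lx).
exact: (@ex_bound_continuous _ _ _ h `|x| (cauchy_schwarz x)).
Qed.

(* riesz is onto by the Riesz representation theorem, so riesz_inv never falls
   back on its default value. *)
Definition riesz (x : X) : dual X := Dual (riesz_subproof x).

Definition riesz_inv (f : dual X) : X := xget 0 [set x | riesz x = f].

End Riesz.

Section Subspaces.
Context {R : realType}.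

Definition linear_subspace (E : lmodType R) (S : set E) : Prop :=
  GRing.submod_closed [in S].

Definition finite_dim_subspace (E : lmodType R) (S : set E) : Prop :=
  exists (n : nat) (e : 'I_n -> E),
    S = [set \sum_(i < n) c i *: e i | c in [set: 'I_n -> R]].

End Subspaces.

Section Form.
Context {R : realType} {Y V : hilbertType R}.
Implicit Types (b : {bounded_biscalar Y -> V}).

Definition inf_sup b (Cb : R) : Prop := forall y : Y,
  Cb * `|y| <= sup [set b y v / `|v| | v in [set v : V | v != 0]].

Definition nondegenerate_right b : Prop :=
  [set v : V | forall y : Y, b y v = 0] = [set 0].

(* Theta_h y is the Riesz representative in the finite-dimensional space Vh of
   the restriction of b(y, .) to Vh; it exists and is unique. *)
Definition Theta b (Vh : set V) (y : Y) : V :=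
  xget 0 [set t | Vh t /\ forall v, Vh v -> inner t v = b y v].

Definition fortin b (Yh : set Y) (Vh : set V) (Pi : V -> V) : Prop :=
  (forall v, Vh (Pi v)) /\
  exists C : R, [/\ 0 < C, forall v, `|Pi v| <= C * `|v| &
    forall y v, Yh y -> b y (v - Pi v) = 0].

End Form.

Section Control.
Context {R : realType} {U Y V W : hilbertType R}.
Context (b : {bounded_biscalar Y -> V}) (D : {bounded_linear U -> dual V}).
Context (O : {bounded_linear Y -> W}) (yd : W) (alpha : R).

Definition cost (y : Y) (u : U) : R :=
  2^-1 * `|O y - yd| ^+ 2 + alpha / 2 * `|u| ^+ 2.

(* Admissible pairs for trial space S, control set K and test space T. *)
Definition admissible (S : set Y) (K : set U) (T : set V) : set (Y * U) :=
  [set p | [/\ S p.1, K p.2 & forall v, T v -> b p.1 v = D p.2 v]].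

Definition optimal (S : set Y) (K : set U) (T : set V) (y : Y) (u : U) : Prop :=
  admissible S K T (y, u) /\
  forall y' u', admissible S K T (y', u') -> cost y u <= cost y' u'.

(* O* I_W^W' (O y - yd) *)
Definition misfit (y : Y) : dual Y := adjoint O (riesz (O y - yd)).

(* Adjoint pair for the state y, sought in S x T and tested against T x S. *)
Definition adjoint_pair (S : set Y) (T : set V) (y : Y) (lam : Y) (p : V) : Prop :=
  [/\ S lam, T p & forall v w, T v -> S w ->
    inner p v - b lam v = 0 /\ b w p = misfit y w].

End Control.

(* Main.v *)
(* The exact state and adjoint equations read [D ubar = B ybar] and
   [O* I (O ybar - yd) = B* pbar], so each discrete residual is the image of the
   errors under bounded operators: [D uh - B yh = B (ybar - yh) - D (ubar - uh)]
   and [O* I (O yh - yd) - B* ph = B* (pbar - ph) - O* I O (ybar - yh)]. *)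
Require Import Defs.
From mathcomp Require Import all_boot all_order all_algebra.
From mathcomp Require Import ring.
From mathcomp Require Import all_classical all_reals all_analysis.

Import Order.TTheory GRing.Theory Num.Theory.
Import numFieldNormedType.Exports.

Local Open Scope classical_set_scope.
Local Open Scope ring_scope.

Lemma dual_subE (R : realType) (E : normedModType R) (f g : dual E) (x : E) :
  (f - g) x = f x - g x.
Proof. by []. Qed.

Theorem theorem4p11 (R : realType) (U Y V W : hilbertType R)
    (b : {bounded_biscalar Y -> V}) (D : {bounded_linear U -> dual V})
    (O : {bounded_linear Y -> W}) (yd : W) (alpha : R) (Uad : set U)
    (alpha_gt0 : 0 < alpha)
    (Uad_neq0 : Uad !=set0) (Uad_bounded : bounded_set Uad)
    (Uad_closed : closed Uad)
    (Uad_convex : convex_set (Uad : set (convex_lmodType U)))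
    (Cb : R) (Cb_gt0 : 0 < Cb) (b_inf_sup : inf_sup b Cb)
    (b_nondegenerate : nondegenerate_right b) :
  exists C : R, 0 < C /\
    forall (Yh : set Y) (Vh : set V) (Uh : set U) (Pi : V -> V)
      (ybar : Y) (ubar : U) (lambdabar : Y) (pbar : V)
      (yh : Y) (uh : U) (lambdah : Y) (ph : V) (ut : U),
    finite_dim_subspace Yh -> finite_dim_subspace Vh -> linear_subspace Uh ->
    Uh `&` Uad !=set0 ->
    fortin b Yh Vh Pi ->
    optimal b D O yd alpha setT Uad setT ybar ubar ->
    adjoint_pair b O yd setT setT ybar lambdabar pbar ->
    optimal b D O yd alpha Yh (Uh `&` Uad) (Theta b Vh @` Yh) yh uh ->
    adjoint_pair b O yd Yh Vh yh lambdah ph ->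
    Uad ut ->
    (forall u, Uad u ->
      0 <= inner (riesz_inv (adjoint_to_dual D ph) + alpha *: ut) (u - ut)) ->
    [/\ `|ut - uh| <= `|ut - ubar| + `|ubar - uh|,
        `|D uh - form_op b yh| <= C * (`|ybar - yh| + `|ubar - uh|) &
        `|adjoint O (riesz (O yh - yd)) - adjoint_to_dual (form_op b) ph|
          <= C * (`|pbar - ph| + `|ybar - yh|)].
Proof.
have [M bM] := @form_bounded _ _ _ b.
have [MD MD0 DM] := continuous_ex_bound (@cts_fun _ _ D).
have [MO MO0 OM] := continuous_ex_bound (@cts_fun _ _ O).
(* The bound [M] may be negative; its absolute value is a bound too, and can enter a sum of
   nonnegative terms. *)
have bM' y v : `|b y v| <= `|M| * `|y| * `|v|.
  by rewrite (le_trans (bM y v))// !ler_wpM2r// ler_norm.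
(* [|M|] bounds both B and its dual, [MD] bounds D and [MO ^+ 2] bounds O* I O; the summand 1 keeps
   the constant positive if all of these vanish. It is fixed before any discretization is chosen. *)
exists (1 + `|M| + MD + MO ^+ 2); split.
  by rewrite -!addrA ltr_pwDl// !addr_ge0// exprn_ge0.
move=> Yh Vh Uh Pi ybar ubar lambdabar pbar yh uh lambdah ph ut _ _ _ _ _.
move=> [[_ _ /= state] _] [_ _ adj] _ _ _ _; split.
- by rewrite (le_trans _ (ler_normD _ _))// subrKA.
- apply: dual_norm_le => [|v]; first by rewrite mulr_ge0 ?addr_ge0 ?exprn_ge0.
  have -> : (D uh - form_op b yh) v = b (ybar - yh) v - D (ubar - uh) v.
    by rewrite linearBl linearB !dual_subE /= state//; ring.
  have bv := bM' (ybar - yh) v.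
  have Dv : `|D (ubar - uh) v| <= MD * `|ubar - uh| * `|v|.
    by rewrite (le_trans (le_dual_norm _ _))// ler_wpM2r// DM.
  rewrite (le_trans (ler_normB _ _))// (le_trans (lerD bv Dv))//.
  (* The coefficients [|M|] and [MD] of the two errors are each a summand of the constant. *)
  rewrite -mulrDl ler_wpM2r// mulrDr lerD// ler_wpM2r//.
    by rewrite -!addrA addrCA lerDl !addr_ge0// exprn_ge0.
  by rewrite -addrA addrCA lerDl !addr_ge0// exprn_ge0.
- apply: dual_norm_le => [|w]; first by rewrite mulr_ge0 ?addr_ge0 ?exprn_ge0.
  have -> : (misfit O yd yh - adjoint_to_dual (form_op b) ph) w
      = b w (pbar - ph) - inner (O (ybar - yh)) (O w).
    (* The second adjoint equation depends on [w] alone, so [0] is a mere placeholder. Once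
       [b w pbar] is replaced by the exact misfit, [yd] cancels. *)
    have [_ bp] := adj 0 w I I.
    rewrite dual_subE [b w (pbar - ph)]linearBr /= bp /misfit.
    rewrite /= /adjoint_fun /= linearB !linearBl /=; ring.
  have bw : `|b w (pbar - ph)| <= `|M| * `|pbar - ph| * `|w|.
    by rewrite mulrAC bM'.
  (* The square arises because O acts on the error and on the test vector. *)
  have Ow : `|inner (O (ybar - yh)) (O w)| <= MO ^+ 2 * `|ybar - yh| * `|w|.
    rewrite (le_trans (cauchy_schwarz _ _))//.
    by rewrite expr2 -mulrA mulrACA ler_pM ?OM.
  rewrite (le_trans (ler_normB _ _))// (le_trans (lerD bw Ow))//.
  rewrite -mulrDl ler_wpM2r// mulrDr lerD// ler_wpM2r//.
    by rewrite -!addrA addrCA lerDl !addr_ge0// exprn_ge0.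
  by rewrite lerDr !addr_ge0.
Qed.
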